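(* Assume $\Omega^*\neq\emptyset$ and let $\sigma\in[0,c]$. Let $\{\omega_k\}$ be generated by the iteration below. Suppose there exist entrywise positive $\theta^*\in\mathbb{R}^{d\times n}$, $\beta^*\in\mathbb{R}^{m\times n}$, a constant $\kappa>0$ and an integer $K_0>0$ such that for every $k\ge K_0$ the error bound condition $$\operatorname{dist}^2_{\mathcal{H}^*}(\widetilde\omega,\Omega^* )\le\frac{\kappa}{16}\,\|\widetilde\omega-\omega_k\|^2_{\mathcal{H}^*},\qquad \widetilde\omega=\mathcal{T}(A,\theta^*,\beta^* )(\omega_k),$$ holds, where $\mathcal{H}^*$ is the operator $\mathcal{H}$ built from the parameters $(A,\theta^*,\beta^* )$. Then there exist parameters $(W_k,\theta_k,\beta_k)\in\mathcal{S}(\sigma,A)$ and a constant $\gamma\in(0,1)$ such that $$\operatorname{dist}^2_{\mathcal{H}_{k+1}}(\omega_{k+1},\Omega^* )<\gamma\,\operatorname{dist}^2_{\mathcal{H}_k}(\omega_k,\Omega^* ),$$ i.e. $\operatorname{dist}^2_{\mathcal{H}_k}(\omega_k,\Omega^* )$ converges to zero linearly.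
   Context: Let $A\in\mathbb{R}^{m\times d}$, $X\in\mathbb{R}^{m\times n}$, and let $f:\mathbb{R}^{d\times n}\to\mathbb{R}$, $g:\mathbb{R}^{m\times n}\to\mathbb{R}$ be convex. Consider the problem $\min_{Z,E} f(Z)+g(E)$ subject to $X=AZ+E$. Triples are written $\omega=(Z,E,-\lambda)$ with $\lambda\in\mathbb{R}^{m\times n}$ a Lagrange multiplier; the inner product of triples is the sum of componentwise Frobenius inner products. $\Omega^*$ is the solution set: the set of $\omega^*=(Z^*,E^*,-\lambda^* )$ with $0\in\partial f(Z^* )+A^\top\lambda^*$, $0\in\partial g(E^* )+\lambda^*$, $AZ^*+E^*=X$. $\circ$ is the Hadamard product; $\beta^{-1}$ is the entrywise reciprocal; $\tfrac{\theta}{2}\circ\|M\|_F^2:=\tfrac12\sum_{ij}\theta_{ij}M_{ij}^2$. Iteration (D-LADMM), with parameters $W_k\in\mathbb{R}^{m\times d}$, $\theta_k\in\mathbb{R}^{d\times n}$, $\beta_k\in\mathbb{R}^{m\times n}$: $Z_{k+1}=\arg\min_Z\{ f(Z)+\tfrac{\theta_k}{2}\circ\|Z-Z_k+\theta_k^{-1}\circ W_k^\top(\lambda_k+\beta_k\circ(AZ_k+E_k-X))\|_F^2\}$, $E_{k+1}=\arg\min_E\{g(E)+\tfrac{\beta_k}{2}\circ\|E-X+AZ_{k+1}+\beta_k^{-1}\circ\lambda_k\|_F^2\}$, $\lambda_{k+1}=\lambda_k+\beta_k\circ(AZ_{k+1}+E_{k+1}-X)$. $\mathcal{T}(W,\theta,\beta)$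 denotes the map sending $\omega_k$ to $\omega_{k+1}$ under one step of this iteration with parameters $(W_k,\theta_k,\beta_k)=(W,\theta,\beta)$. For parameters $(W,\theta,\beta)$: $\mathcal{D}(Z)=\theta\circ Z-W^\top(\beta\circ(AZ))$ and $\mathcal{H}(Z,E,-\lambda)=(\mathcal{D}(Z),\ \beta\circ E,\ \beta^{-1}\circ(-\lambda))$; $\mathcal{H}_k$ is this operator for $(W_k,\theta_k,\beta_k)$. $\|\omega\|_{\mathcal{H}}^2=\langle\omega,\mathcal{H}(\omega)\rangle$; $\operatorname{dist}^2_{\mathcal{H}}(\omega,\Omega^* )=\min_{\omega^*\in\Omega^*}\|\omega-\omega^*\|^2_{\mathcal{H}}$. $\mathcal{S}(\sigma,A)$ is the set of $(W,\theta,\beta)$ with $\|W-A\|\le\sigma$ (spectral norm), $\theta,\beta$ entrywise positive, and $Z\mapsto\theta\circ Z-W^\top(\beta\circ(AZ))$ positive definite ($\langle\cdot(Z),Z\rangle>0$ for $Z\neq0$). Standing assumption: there is a constant $c$ such that $\mathcal{S}(\sigma,A)\ne\emptyset$ for all $0\le\sigma\le c$.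
   Formalization: The strict inequality in the contraction is replaced by a non-strict one (for k ≥ K_0), since the strict one fails when the distance of ω_k to Ω* is zero, e.g. σ = 0 and ω_0 already in Ω*; for positive distance the strict form follows with a slightly larger γ. *)

(* Defs.v *)
From HB Require Import structures.
From mathcomp Require Import all_boot all_order all_algebra.
From mathcomp Require Import classical_sets reals constructive_ereal ereal.
Set Implicit Arguments. Unset Strict Implicit. Unset Printing Implicit Defensive.
Import Order.TTheory GRing.Theory Num.Theory.
Local Open Scope ring_scope.
Local Open Scope classical_set_scope.

Definition frob (R : realType) (p q : nat) (M N : 'M[R]_(p, q)) : R :=
  \sum_(i < p) \sum_(j < q) M i j * N i j.

Definition hada (R : realType) (p q : nat) (M N : 'M[R]_(p, q)) : 'M[R]_(p, q) :=
  \matrix_(i, j) (M i j * N i j).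
Definition recip (R : realType) (p q : nat) (M : 'M[R]_(p, q)) : 'M[R]_(p, q) :=
  \matrix_(i, j) (M i j)^-1.

Definition whnorm (R : realType) (p q : nat) (th M : 'M[R]_(p, q)) : R :=
  2^-1 * \sum_(i < p) \sum_(j < q) th i j * M i j ^+ 2.

Definition entrywise_pos (R : realType) (p q : nat) (M : 'M[R]_(p, q)) : Prop :=
  forall i j, 0 < M i j.

Definition specnorm (R : realType) (p q : nat) (M : 'M[R]_(p, q)) : R :=
  sup [set Num.sqrt (frob (M *m v) (M *m v)) | v in [set v : 'cV[R]_q | frob v v <= 1]].

Definition convex_fun (R : realType) (p q : nat) (f : 'M[R]_(p, q) -> R) : Prop :=
  forall (x y : 'M[R]_(p, q)) (t : R), 0 <= t <= 1 ->
    f (t *: x + (1 - t) *: y) <= t * f x + (1 - t) * f y.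

Definition subdiff (R : realType) (p q : nat) (f : 'M[R]_(p, q) -> R) (Z : 'M[R]_(p, q))
  : set 'M[R]_(p, q) :=
  [set G | forall Y, f Z + frob G (Y - Z) <= f Y].

Definition is_argmin (T : Type) (R : realType) (F : T -> R) (x : T) : Prop :=
  forall y, F x <= F y.

(* triples omega = (Z, E, -lambda) *)
Definition triple (R : realType) (m d n : nat) : Type :=
  ('M[R]_(d, n) * 'M[R]_(m, n) * 'M[R]_(m, n))%type.

Definition mkomega (R : realType) (m d n : nat)
  (Z : 'M[R]_(d, n)) (E : 'M[R]_(m, n)) (lam : 'M[R]_(m, n)) : triple R m d n :=
  (Z, E, - lam).

Definition tsub (R : realType) (m d n : nat) (w w' : triple R m d n) : triple R m d n :=
  (w.1.1 - w'.1.1, w.1.2 - w'.1.2, w.2 - w'.2).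

Definition tinner (R : realType) (m d n : nat) (w w' : triple R m d n) : R :=
  frob w.1.1 w'.1.1 + frob w.1.2 w'.1.2 + frob w.2 w'.2.

Definition Dop (R : realType) (m d n : nat) (A W : 'M[R]_(m, d))
  (th : 'M[R]_(d, n)) (be : 'M[R]_(m, n)) (Z : 'M[R]_(d, n)) : 'M[R]_(d, n) :=
  hada th Z - W^T *m hada be (A *m Z).

Definition Hop (R : realType) (m d n : nat) (A W : 'M[R]_(m, d))
  (th : 'M[R]_(d, n)) (be : 'M[R]_(m, n)) (w : triple R m d n) : triple R m d n :=
  (Dop A W th be w.1.1, hada be w.1.2, hada (recip be) w.2).

Definition Hnorm2 (R : realType) (m d n : nat) (A W : 'M[R]_(m, d))
  (th : 'M[R]_(d, n)) (be : 'M[R]_(m, n)) (w : triple R m d n) : R :=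
  tinner w (Hop A W th be w).

Definition Omega_star (R : realType) (m d n : nat) (A : 'M[R]_(m, d)) (X : 'M[R]_(m, n))
  (f : 'M[R]_(d, n) -> R) (g : 'M[R]_(m, n) -> R) : set (triple R m d n) :=
  [set w | exists Z E lam, w = mkomega Z E lam /\
     subdiff f Z (- (A^T *m lam)) /\ subdiff g E (- lam) /\ A *m Z + E = X].

(* dist^2_H(w, Omega_star) = min over Omega_star (taken as an infimum in extended reals) *)
Definition dist2 (R : realType) (m d n : nat) (A W : 'M[R]_(m, d))
  (th : 'M[R]_(d, n)) (be : 'M[R]_(m, n)) (Om : set (triple R m d n))
  (w : triple R m d n) : \bar R :=
  ereal_inf [set (Hnorm2 A W th be (tsub w ws))%:E | ws in Om].

(* one D-LADMM step with parameters (W, theta, beta): w' = T(W,theta,beta)(w) *)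
Definition dladmm_step (R : realType) (m d n : nat) (A : 'M[R]_(m, d)) (X : 'M[R]_(m, n))
  (f : 'M[R]_(d, n) -> R) (g : 'M[R]_(m, n) -> R)
  (W : 'M[R]_(m, d)) (th : 'M[R]_(d, n)) (be : 'M[R]_(m, n))
  (w w' : triple R m d n) : Prop :=
  let Zk := w.1.1 in let Ek := w.1.2 in let lk := - w.2 in
  let Z1 := w'.1.1 in let E1 := w'.1.2 in let l1 := - w'.2 in
  is_argmin (fun Z => f Z + whnorm th
      (Z - Zk + hada (recip th) (W^T *m (lk + hada be (A *m Zk + Ek - X))))) Z1 /\
  is_argmin (fun E => g E + whnorm be (E - X + A *m Z1 + hada (recip be) lk)) E1 /\
  l1 = lk + hada be (A *m Z1 + E1 - X).

Definition Sset (R : realType) (m d n : nat) (A : 'M[R]_(m, d)) (sigma : R)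
  (W : 'M[R]_(m, d)) (th : 'M[R]_(d, n)) (be : 'M[R]_(m, n)) : Prop :=
  specnorm (W - A) <= sigma /\ entrywise_pos th /\ entrywise_pos be /\
  (forall Z : 'M[R]_(d, n), Z != 0 -> 0 < frob (Dop A W th be Z) Z).

(* Main.v *)
(** Constant parameters [(A, s *: th_star, be_star)] with [s] large enough to make the
    [H]-norm positive definite already work.  One step decreases the [H]-distance to
    every solution by at least the squared [H]-length of the step, provided
    [- lambda_k] is a subgradient of [g] at [E_k], which holds from [k = 1] on.

    The error bound is about the step with parameters [(A, th_star, be_star)], whose form
    [H] may be indefinite.  The constraint [A Z + E = X], satisfied by solutions and,
    up to the multiplier increment, by the trial point, turns it into a Euclidean error
    bound.  The trial point and the actual next iterate solve proximal problems that
    differ only in the step size, so their distance is controlled by the actual step.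
    Hence [dist^2 <= C * step^2] at the new point and the contraction factor is
    [C / (1 + C)].

    The trial point exists because [f] and [g] are bounded below by affine functions
    (their subgradients at a solution): minimising sequences of the proximal objective
    are Cauchy by strong convexity, and convex functions are lower semicontinuous. *)

Require Import Defs.
From HB Require Import structures.
From mathcomp Require Import all_boot all_order all_algebra.
From mathcomp Require Import classical_sets reals constructive_ereal ereal.
From mathcomp Require Import ring lra.
Import Order.TTheory GRing.Theory Num.Theory.
Local Open Scope ring_scope.
Local Open Scope classical_set_scope.

(** * Algebra of the Frobenius and Hadamard products *)

Lemma frobC {R : realType} {p q} (M N : 'M[R]_(p, q)) : frob M N = frob N M.
Proof. by apply: eq_bigr => i _; apply: eq_bigr => j _; rewrite mulrC. Qed.

Lemma frobDl {R : realType} {p q} (M M' N : 'M[R]_(p, q)) :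
  frob (M + M') N = frob M N + frob M' N.
Proof.
rewrite /frob -big_split; apply: eq_bigr => i _ /=.
by rewrite -big_split; apply: eq_bigr => j _; rewrite mxE mulrDl.
Qed.

Lemma frobZl {R : realType} {p q} a (M N : 'M[R]_(p, q)) :
  frob (a *: M) N = a * frob M N.
Proof.
rewrite /frob mulr_sumr; apply: eq_bigr => i _.
by rewrite mulr_sumr; apply: eq_bigr => j _; rewrite mxE mulrA.
Qed.

Lemma frobNl {R : realType} {p q} (M N : 'M[R]_(p, q)) : frob (- M) N = - frob M N.
Proof. by rewrite -scaleN1r frobZl mulN1r. Qed.

Lemma frobBl {R : realType} {p q} (M M' N : 'M[R]_(p, q)) :
  frob (M - M') N = frob M N - frob M' N.
Proof. by rewrite frobDl frobNl. Qed.

Lemma frobDr {R : realType} {p q} (M N N' : 'M[R]_(p, q)) :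
  frob M (N + N') = frob M N + frob M N'.
Proof. by rewrite frobC frobDl !(frobC M). Qed.

Lemma frobZr {R : realType} {p q} a (M N : 'M[R]_(p, q)) :
  frob M (a *: N) = a * frob M N.
Proof. by rewrite frobC frobZl frobC. Qed.

Lemma frobNr {R : realType} {p q} (M N : 'M[R]_(p, q)) : frob M (- N) = - frob M N.
Proof. by rewrite frobC frobNl frobC. Qed.

Lemma frobBr {R : realType} {p q} (M N N' : 'M[R]_(p, q)) :
  frob M (N - N') = frob M N - frob M N'.
Proof. by rewrite frobDr frobNr. Qed.

Definition frobE := (@frobDl, @frobDr, @frobNl, @frobNr, @frobZl, @frobZr).

Lemma frob_adj {R : realType} {m d n} (A : 'M[R]_(m, d)) (M : 'M[R]_(m, n)) Z :
  frob (A^T *m M) Z = frob M (A *m Z).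
Proof.
rewrite /frob.
under eq_bigr => i _ do under eq_bigr => j _ do rewrite mxE mulr_suml.
under [RHS]eq_bigr => i _ do under eq_bigr => j _ do rewrite mxE mulr_sumr.
rewrite exchange_big [RHS]exchange_big; apply: eq_bigr => j _ /=.
rewrite exchange_big; apply: eq_bigr => i _; apply: eq_bigr => k _ /=.
by rewrite mxE; ring.
Qed.

Lemma hadaD {R : realType} {p q} (a M N : 'M[R]_(p, q)) :
  hada a (M + N) = hada a M + hada a N.
Proof. by apply/matrixP => i j; rewrite !mxE mulrDr. Qed.

Lemma hadaN {R : realType} {p q} (a M : 'M[R]_(p, q)) : hada a (- M) = - hada a M.
Proof. by apply/matrixP => i j; rewrite !mxE mulrN. Qed.

Lemma hadaZ {R : realType} {p q} c (a M : 'M[R]_(p, q)) :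
  hada a (c *: M) = c *: hada a M.
Proof. by apply/matrixP => i j; rewrite !mxE; ring. Qed.

Lemma frob_hada {R : realType} {p q} (a M N : 'M[R]_(p, q)) :
  frob M (hada a N) = frob (hada a M) N.
Proof. by apply: eq_bigr => i _; apply: eq_bigr => j _; rewrite !mxE; ring. Qed.

Lemma hadaK {R : realType} {p q} (a M : 'M[R]_(p, q)) :
  entrywise_pos a -> hada (recip a) (hada a M) = M.
Proof. by move=> a0; apply/matrixP => i j; rewrite !mxE mulKf// gt_eqF. Qed.

Lemma hadaVK {R : realType} {p q} (a M : 'M[R]_(p, q)) :
  entrywise_pos a -> hada a (hada (recip a) M) = M.
Proof. by move=> a0; apply/matrixP => i j; rewrite !mxE mulVKf// gt_eqF. Qed.

Lemma recip_pos {R : realType} {p q} (a : 'M[R]_(p, q)) :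
  entrywise_pos a -> entrywise_pos (recip a).
Proof. by move=> a0 i j; rewrite mxE invr_gt0. Qed.

(** * Weighted squared norms and their comparison constants *)

Definition wsq {R : realType} {p q} (a M : 'M[R]_(p, q)) : R := frob M (hada a M).

Lemma wsqE {R : realType} {p q} (a M : 'M[R]_(p, q)) :
  wsq a M = \sum_(i < p) \sum_(j < q) a i j * M i j ^+ 2.
Proof. by apply: eq_bigr => i _; apply: eq_bigr => j _; rewrite !mxE; ring. Qed.

Lemma whnormE {R : realType} {p q} (a M : 'M[R]_(p, q)) : whnorm a M = 2^-1 * wsq a M.
Proof. by rewrite wsqE. Qed.

Lemma wsqD {R : realType} {p q} (a M N : 'M[R]_(p, q)) :
  wsq a (M + N) = wsq a M + 2 * frob M (hada a N) + wsq a N.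
Proof.
rewrite /wsq hadaD !frobE (frobC N (hada a M)) -frob_hada.
by ring.
Qed.

Lemma wsqN {R : realType} {p q} (a M : 'M[R]_(p, q)) : wsq a (- M) = wsq a M.
Proof. by rewrite /wsq hadaN !frobE opprK. Qed.

Lemma wsqZ {R : realType} {p q} c (a M : 'M[R]_(p, q)) : wsq a (c *: M) = c ^+ 2 * wsq a M.
Proof. by rewrite /wsq hadaZ !frobE; ring. Qed.

Lemma wsqB {R : realType} {p q} (a M N : 'M[R]_(p, q)) :
  wsq a (M - N) = wsq a M - 2 * frob M (hada a N) + wsq a N.
Proof. by rewrite wsqD wsqN hadaN !frobE; ring. Qed.

Lemma wsq_ge0 {R : realType} {p q} (a M : 'M[R]_(p, q)) : entrywise_pos a -> 0 <= wsq a M.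
Proof.
move=> a0; rewrite wsqE; apply: sumr_ge0 => i _; apply: sumr_ge0 => j _.
by rewrite mulr_ge0 ?sqr_ge0// ltW.
Qed.

Lemma wsq_entry {R : realType} {p q} (a M : 'M[R]_(p, q)) i j :
  entrywise_pos a -> a i j * M i j ^+ 2 <= wsq a M.
Proof.
move=> a0; have t0 k l : 0 <= a k l * M k l ^+ 2 by rewrite mulr_ge0 ?sqr_ge0// ltW.
rewrite wsqE (bigD1 i)//= (bigD1 j)//= -addrA lerDl addr_ge0// sumr_ge0// => k _.
exact: sumr_ge0.
Qed.

(** Expand [0 <= wsq a (e *: M - N)] and divide by [e]. *)
Lemma wsq_young {R : realType} {p q} (a M N : 'M[R]_(p, q)) (e : R) :
  entrywise_pos a -> 0 < e ->
  2 * frob M (hada a N) <= e * wsq a M + e^-1 * wsq a N.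
Proof.
move=> a0 e0; have := wsq_ge0 a (e *: M - N) a0.
rewrite wsqB wsqZ !frobE => H.
rewrite -(ler_pM2l e0) mulrDr mulVKf ?gt_eqF//.
nra.
Qed.

Lemma wsqD_le {R : realType} {p q} (a M N : 'M[R]_(p, q)) :
  entrywise_pos a -> wsq a (M + N) <= 2 * (wsq a M + wsq a N).
Proof.
by move=> a0; have := wsq_young a M N 1 a0 ltr01; rewrite wsqD invr1 !mul1r; lra.
Qed.

Lemma wsq_equiv {R : realType} {p q} (a b : 'M[R]_(p, q)) : entrywise_pos b ->
  exists2 C : R, 0 < C & forall M, wsq a M <= C * wsq b M.
Proof.
move=> b0; pose C := 1 + \sum_i \sum_j `|a i j| / b i j.
have t0 i j : 0 <= `|a i j| / b i j by rewrite divr_ge0// ltW.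
have C1 : 1 <= C by rewrite lerDl; apply: sumr_ge0 => i _; apply: sumr_ge0.
exists C => [|M]; first exact: lt_le_trans C1.
rewrite !wsqE mulr_sumr ler_sum// => i _; rewrite mulr_sumr ler_sum// => j _.
rewrite mulrA ler_wpM2r ?sqr_ge0//.
have: `|a i j| / b i j <= C.
  rewrite /C (bigD1 i)//= (bigD1 j)//= addrCA -addrA lerDl !addr_ge0//.
    by apply: sumr_ge0.
  by apply: sumr_ge0 => k _; apply: sumr_ge0.
by rewrite ler_pdivrMr//; apply: le_trans; exact: ler_norm.
Qed.

(** Iterates [(x + y)^2 <= 2 x^2 + 2 y^2]. The constant is crude, but below only its finiteness
    matters. *)
Lemma sqr_sum_le {R : realType} {I : Type} (r : seq I) (x : I -> R) :
  (\sum_(i <- r) x i) ^+ 2 <= 2 ^+ size r * \sum_(i <- r) x i ^+ 2.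
Proof.
elim: r => [|i r IH]; first by rewrite !big_nil expr0n mulr0.
rewrite !big_cons /= (exprS 2).
have r1 : 1 <= 2 ^+ size r :> R by rewrite exprn_ege1// ler1n.
set S := \sum_(i <- r) x i in IH *; set T := \sum_(i <- r) x i ^+ 2 in IH *.
have := ler_wpM2r (sqr_ge0 (x i)) r1.
move: (2 ^+ size r) IH => P IH; have := sqr_ge0 (x i - S).
by lra.
Qed.

Lemma wsq_mul_le {R : realType} {m d n} (A : 'M[R]_(m, d)) (a : 'M[R]_(m, n))
    (b : 'M[R]_(d, n)) : entrywise_pos a -> entrywise_pos b ->
  exists2 C : R, 0 < C & forall Z, wsq a (A *m Z) <= C * wsq b Z.
Proof.
move=> a0 b0.
have [K K0 HK] := wsq_equiv (const_mx 1 : 'M[R]_(d, n)) b b0.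
pose r := index_enum 'I_d.
pose C := 1 + \sum_i \sum_j a i j * (2 ^+ size r * \sum_k A i k ^+ 2 ) * K.
have s0 i : 0 <= \sum_k A i k ^+ 2 by apply: sumr_ge0 => k _; exact: sqr_ge0.
have t0 i j : 0 <= a i j * (2 ^+ size r * \sum_k A i k ^+ 2) * K.
  by rewrite !mulr_ge0// ltW.
exists C => [|Z].
  by rewrite ltr_pwDl// sumr_ge0// => i _; rewrite sumr_ge0.
have b00 := wsq_ge0 b Z b0.
rewrite wsqE mulrDl mul1r ler_wpDl// mulr_suml ler_sum// => i _.
rewrite mulr_suml ler_sum// => j _; rewrite -!mulrA ler_wpM2l//; first exact: ltW.
rewrite mxE (le_trans (sqr_sum_le _ _))// ler_wpM2l// mulr_suml ler_sum// => k _.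
rewrite exprMn ler_wpM2l ?sqr_ge0//.
apply: le_trans (HK Z).
have := @wsq_entry _ _ _ (const_mx 1 : 'M[R]_(d, n)) Z k j.
by rewrite mxE mul1r; apply=> x y; rewrite mxE.
Qed.

(** * Continuity of finite convex functions *)

Lemma convex_usc_line {R : realType} {p q} (f : 'M[R]_(p, q) -> R) (x h : 'M[R]_(p, q))
    (e : R) : convex_fun f -> 0 < e ->
  exists2 del : R, 0 < del & forall s, `|s| <= del -> f (x + s *: h) <= f x + e.
Proof.
move=> cf e0; pose M := 1 + `|f (x + h) - f x| + `|f (x - h) - f x|.
have M0 : 0 < M by rewrite !ltr_pwDl.
have [M1 M2] : f (x + h) - f x <= M /\ f (x - h) - f x <= M.
  have := ler_norm (f (x + h) - f x); have := ler_norm (f (x - h) - f x).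
  have := normr_ge0 (f (x + h) - f x); have := normr_ge0 (f (x - h) - f x).
  by rewrite /M; split; lra.
have key k s : f (x + k) - f x <= M -> 0 <= s -> s <= Num.min 1 (e / M) ->
    f (x + s *: k) <= f x + e.
  move=> kM s0; rewrite le_min ler_pdivlMr// => /andP[s1 sM].
  (* For [0 <= s <= 1] the point lies on the segment from [x] to [x + k], so [f] rises by at most
     [s * M]. *)
  have -> : x + s *: k = s *: (x + k) + (1 - s) *: x.
    by apply/matrixP => i j; rewrite !mxE; ring.
  apply: le_trans (cf _ _ s _) _; first by rewrite s0.
  nra.
exists (Num.min 1 (e / M)) => [|s]; first by rewrite lt_min ltr01 divr_gt0.
have [s0|s0] := ger0P s; first exact: key.
by move=> sd; rewrite -[s]opprK scaleNr -scalerN; apply: key => //; rewrite oppr_ge0 ltW.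
Qed.

Lemma convex_half {R : realType} {p q} (f : 'M[R]_(p, q) -> R) (x y : 'M[R]_(p, q)) :
  convex_fun f -> f (2^-1 *: x + 2^-1 *: y) <= 2^-1 * f x + 2^-1 * f y.
Proof.
move=> cf; have := cf x y 2^-1.
have -> : 1 - 2^-1 = 2^-1 :> R by lra.
by apply; rewrite invr_ge0 ler0n invf_le1 ?ltr0n// ler1n.
Qed.

(** Induction over the coordinates: the displaced point is the midpoint of one moved twice as far
    along a single coordinate and one moved twice as far along the others. *)
Lemma convex_usc {R : realType} {p q} (f : 'M[R]_(p, q) -> R) (x : 'M[R]_(p, q)) (e : R) :
  convex_fun f -> 0 < e ->
  exists2 del : R, 0 < del & forall h : 'M[R]_(p, q), (forall i j, `|h i j| <= del) ->
    f (x + h) <= f x + e.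
Proof.
move=> cf e0.
suff key (r : seq ('I_p * 'I_q)) : exists2 del : R, 0 < del &
    forall t : 'I_p * 'I_q -> R, (forall i, `|t i| <= del) ->
    f (x + \sum_(i <- r) t i *: delta_mx i.1 i.2) <= f x + e.
  have [del del0 Hd] := key (index_enum _); exists del => // h hd.
  rewrite [h]matrix_sum_delta pair_big /=.
  by apply: (Hd (fun i => h i.1 i.2)) => i.
elim: r => [|i r [d1 d10 H1]].
  by exists 1 => // t _; rewrite big_nil addr0 lerDl ltW.
have [d2 d20 H2] := convex_usc_line f x (delta_mx i.1 i.2) e cf e0.
exists (2^-1 * Num.min d1 d2) => [|t Ht].
  by rewrite mulr_gt0 ?invr_gt0 ?ltr0n// lt_min d10.
have {}Ht k : `|2 * t k| <= d1 /\ `|2 * t k| <= d2.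
  by apply/andP; rewrite -le_min normrM ger0_norm// -ler_pdivlMl ?ltr0n.
rewrite big_cons.
have -> : x + (t i *: delta_mx i.1 i.2 + \sum_(j <- r) t j *: delta_mx j.1 j.2) =
   2^-1 *: (x + (2 * t i) *: delta_mx i.1 i.2)
   + 2^-1 *: (x + \sum_(j <- r) (2 * t j) *: delta_mx j.1 j.2).
  under [in RHS]eq_bigr => j _ do rewrite -scalerA.
  rewrite -scaler_sumr; apply/matrixP => k l; rewrite !mxE.
  by field.
apply: le_trans (convex_half _ _ _ cf) _.
have := H2 _ (Ht i).2; have := H1 (fun j => 2 * t j) (fun j => (Ht j).1).
lra.
Qed.

(** [x] is the midpoint of [y] and its reflection [x + (x - y)], where upper semicontinuity bounds
    [f]. *)
Lemma convex_lsc {R : realType} {p q} (f : 'M[R]_(p, q) -> R) (x : 'M[R]_(p, q)) (e : R) :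
  convex_fun f -> 0 < e ->
  exists2 del : R, 0 < del & forall y : 'M[R]_(p, q),
    (forall i j, `|y i j - x i j| <= del) -> f x <= f y + e.
Proof.
move=> cf e0; have [del del0 Hd] := convex_usc f x e cf e0.
exists del => // y Hy.
have /Hd : forall i j, `|(x - y) i j| <= del by move=> i j; rewrite !mxE distrC.
have := convex_half f (x + (x - y)) y cf.
have -> : 2^-1 *: (x + (x - y)) + 2^-1 *: y = x.
  by apply/matrixP => i j; rewrite !mxE; field.
lra.
Qed.

(** * Proximal problems: existence and optimality of minimisers *)

Definition prox_obj {R : realType} {p q} (f : 'M[R]_(p, q) -> R) (a P Z : 'M[R]_(p, q)) : R :=
  f Z + whnorm a (Z - P).

(** The quadratic term misses linearity along a segment by exactly
    [2^-1 * t * (1 - t) * wsq a (x - y)]; this is the strong convexity used twice below. *)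
Lemma prox_obj_convex {R : realType} {p q} (f : 'M[R]_(p, q) -> R) (a P x y : 'M[R]_(p, q))
    (t : R) : convex_fun f -> 0 <= t <= 1 ->
  prox_obj f a P (t *: x + (1 - t) *: y) <=
  t * prox_obj f a P x + (1 - t) * prox_obj f a P y - 2^-1 * t * (1 - t) * wsq a (x - y).
Proof.
move=> cf t01; have := cf x y t t01; rewrite /prox_obj !whnormE.
have -> : t *: x + (1 - t) *: y - P = (y - P) + t *: (x - y).
  by apply/matrixP => i j; rewrite !mxE; ring.
have -> : x - P = (y - P) + (x - y) by apply/matrixP => i j; rewrite !mxE; ring.
move: (x - y) (y - P) => u v.
by rewrite !wsqD wsqZ hadaZ frobZr; lra.
Qed.

Lemma prox_exists {R : realType} {p q} (f : 'M[R]_(p, q) -> R) (a P Z0 G : 'M[R]_(p, q)) :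
  convex_fun f -> entrywise_pos a -> subdiff f Z0 G ->
  exists Z, is_argmin (prox_obj f a P) Z.
Proof.
move=> cf a0 HG; set F := prox_obj f a P.
have cF : convex_fun F.
  move=> x y t t01; have := prox_obj_convex f a P x y t cf t01.
  have := wsq_ge0 a (x - y) a0; case/andP: t01 => t0 t1.
  rewrite -/F; set Q := wsq _ _ => Q0; rewrite -subr_ge0 in t1.
  by have := mulr_ge0 (mulr_ge0 t0 t1) Q0; lra.
pose S := [set F Z | Z in setT].
have S0 : has_inf S.
  split; first by exists (F Z0); exists Z0.
  (* The subgradient gives an affine minorant; its linear term in [Z - P] is absorbed by completing
     the square with [hada (recip a) G]. *)
  exists (f Z0 + frob G (P - Z0) - 2^-1 * wsq (recip a) G) => _ [Z _ <-].
  have := HG Z; rewrite /F /prox_obj whnormE.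
  have -> : Z - Z0 = (Z - P) + (P - Z0) by rewrite addrA subrK.
  have := wsq_ge0 a ((Z - P) + hada (recip a) G) a0.
  move: (Z - P) (P - Z0) => U V.
  rewrite wsqD /wsq hadaVK// frobDr (frobC U G) (frobC (hada _ G) G).
  lra.
pose I := inf S.
have IF Z : I <= F Z by apply: ge_inf; [exact: S0.2 | exists Z].
have near_inf (e : R) : 0 < e -> exists Z, F Z < I + e.
  by move=> e0; have [_ [Z _ <-] ?] := inf_adherent e0 S0; exists Z.
pose gap Z := F Z - I.
have gap0 Z : 0 <= gap Z by rewrite subr_ge0.
(* Strong convexity at the midpoint of [Y] and [Z], whose value is at least [I]. *)
have gap_le (Y Z : 'M[R]_(p, q)) : wsq a (Y - Z) <= 4 * (gap Y + gap Z).
  have h01 : (0 <= 2^-1 :> R) && (2^-1 <= 1 :> R) by apply/andP; split; lra.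
  have := prox_obj_convex f a P Y Z 2^-1 cf h01; rewrite -/F.
  by have := IF (2^-1 *: Y + (1 - 2^-1) *: Z); rewrite /gap; lra.
pose e i j Z := Num.sqrt (4 * gap Z / a i j).
have e0 i j Z : 0 <= e i j Z by exact: sqrtr_ge0.
have e2 i j Z : e i j Z ^+ 2 = 4 * gap Z / a i j.
  by rewrite sqr_sqrtr// mulr_ge0 ?invr_ge0 ?mulr_ge0// ltW.
have close i j (Y Z : 'M[R]_(p, q)) : Y i j - Z i j <= e i j Y + e i j Z.
  have : (Y i j - Z i j) ^+ 2 <= e i j Y ^+ 2 + e i j Z ^+ 2.
    rewrite !e2 -mulrDl -mulrDr ler_pdivlMr// mulrC (le_trans _ (gap_le Y Z))//.
    by have := wsq_entry a (Y - Z) i j a0; rewrite !mxE.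
  have := e0 i j Y; have := e0 i j Z; nra.
(* The candidate minimiser is read off entrywise: all intervals
   [Y i j - e i j Y, Y i j + e i j Y] meet, and [sup] picks a common point. *)
pose x : 'M[R]_(p, q) := \matrix_(i, j) sup [set Z i j - e i j Z | Z in [set: 'M[R]_(p, q)]].
have xP i j (Z : 'M[R]_(p, q)) : `|Z i j - x i j| <= e i j Z.
  have ubS (Y : 'M[R]_(p, q)) : ubound [set Z i j - e i j Z | Z in [set: 'M[R]_(p, q)]] (Y i j + e i j Y).
    by move=> _ [Z' _ <-]; have := close i j Z' Y; lra.
  rewrite mxE ler_distlC; apply/andP; split.
    by apply: ub_le_sup; [exists (Z i j + e i j Z); exact: ubS | exists Z].
  by apply: ge_sup; [exists (Z i j - e i j Z); exists Z | exact: ubS].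
exists x => y.
suff : F x <= I by move=> /le_trans; apply.
apply/ler_addgt0Pr => eps eps0.
have eps20 : 0 < eps / 2 by rewrite divr_gt0.
have [del del0 Hd] := convex_lsc F x (eps / 2) cF eps20.
have [amin am0 Ham] : exists2 b : R, 0 < b & forall i j, (a i j)^-1 <= b.
  exists (1 + \sum_i \sum_j (a i j)^-1) => [|i j].
    by rewrite ltr_pwDl// !sumr_ge0// => i _; rewrite sumr_ge0// => j _; rewrite invr_ge0 ltW.
  rewrite (bigD1 i)//= (bigD1 j)//= addrCA -addrA lerDl !addr_ge0//.
    by rewrite sumr_ge0// => k _; rewrite invr_ge0 ltW.
  by rewrite sumr_ge0// => k _; rewrite sumr_ge0// => l _; rewrite invr_ge0 ltW.
(* The first bound keeps [F Z] within [eps / 2] of [I]; the second forces [e i j Z <= del], since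
   [amin] bounds every reciprocal weight from above. *)
have r0 : 0 < Num.min (eps / 2) (del ^+ 2 / (4 * amin)).
  by rewrite lt_min eps20 divr_gt0 ?exprn_gt0// mulr_gt0.
have [Z] := near_inf _ r0; rewrite -ltrBlDl -/(gap Z) lt_min => /andP[g1 g2].
have : F x <= F Z + eps / 2.
  apply: Hd => i j; apply: le_trans (xP i j Z) _.
  rewrite -(ler_pXn2r (n := 2))// ?nnegrE ?(ltW del0)// e2.
  move: g2; rewrite ltr_pdivlMr ?mulr_gt0// => g2; apply: le_trans (ltW g2).
  by rewrite (mulrC 4) -mulrA ler_wpM2l// ler_wpM2l.
rewrite /gap in g1; lra.
Qed.

(** Strong convexity makes the objective grow by at least [2^-1 * wsq a (Y - Z)] away from its
    minimiser. Expanding the two quadratic terms then leaves exactly the subgradient inequality. *)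
Lemma argmin_subdiff {R : realType} {p q} (f : 'M[R]_(p, q) -> R) (a P Z : 'M[R]_(p, q)) :
  convex_fun f -> entrywise_pos a -> is_argmin (prox_obj f a P) Z ->
  subdiff f Z (hada a (P - Z)).
Proof.
move=> cf a0 minZ Y; have Q0 := wsq_ge0 a (Y - Z) a0.
suff : prox_obj f a P Z + 2^-1 * wsq a (Y - Z) <= prox_obj f a P Y.
  rewrite /prox_obj !whnormE.
  have -> : Y - P = (Y - Z) + (Z - P) by apply/matrixP => i j; rewrite !mxE; ring.
  have -> : P - Z = - (Z - P) by rewrite opprB.
  move: (Y - Z) (Z - P) => U V.
  by rewrite wsqD hadaN frobNl -frob_hada (frobC V) -frob_hada; lra.
apply/ler_addgt0Pr => eps eps0.
(* Comparing [Z] with [t *: Y + (1 - t) *: Z] and dividing by [t] leaves an error of order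
   [t * wsq a (Y - Z)], which this choice keeps below [eps]. *)
pose t := Num.min 1 (eps / (wsq a (Y - Z) + 1)).
have Q1 : 0 < wsq a (Y - Z) + 1 by rewrite ltr_wpDl.
have t0 : 0 < t by rewrite lt_min ltr01 divr_gt0.
have t1 : t <= 1 by rewrite ge_min lexx.
have tQ : t * (wsq a (Y - Z) + 1) <= eps.
  by rewrite -ler_pdivlMr// ge_min lexx orbT.
have t01 : (0 <= t) && (t <= 1) by rewrite t1 ltW.
have := prox_obj_convex f a P Y Z t cf t01; have := minZ (t *: Y + (1 - t) *: Z).
move: (prox_obj f a P Y) (prox_obj f a P Z) (prox_obj f a P _) (wsq a _) tQ Q0.
move=> FY FZ FM Q tQ Q0 H1 H2.
by rewrite -(ler_pM2l t0); nra.
Qed.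

(** * Monotone subgradients and the optimality conditions of one step *)

Lemma subdiff_monotone {R : realType} {p q} (f : 'M[R]_(p, q) -> R) (x y u v : 'M[R]_(p, q)) :
  subdiff f x u -> subdiff f y v -> 0 <= frob (u - v) (x - y).
Proof. by move=> /(_ y) + /(_ x); rewrite !frobE; lra. Qed.

Lemma is_argmin_ext {T : Type} {R : realType} (F G : T -> R) x :
  F =1 G -> is_argmin F x -> is_argmin G x.
Proof. by move=> FG + y => /(_ y); rewrite !FG. Qed.

Lemma dladmm_stepP {R : realType} {m d n} (A W : 'M[R]_(m, d)) (X : 'M[R]_(m, n)) f g
    (th : 'M[R]_(d, n)) be (w w' : triple R m d n) :
  dladmm_step A X f g W th be w w' <->
  [/\ is_argmin (prox_obj f th (w.1.1 - hada (recip th)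
        (W^T *m (hada be (A *m w.1.1 + w.1.2 - X) - w.2)))) w'.1.1,
      is_argmin (prox_obj g be (X - A *m w'.1.1 + hada (recip be) w.2)) w'.1.2 &
      w'.2 = w.2 - hada be (A *m w'.1.1 + w'.1.2 - X)].
Proof.
have Ef Z : f Z + whnorm th (Z - w.1.1 + hada (recip th)
      (W^T *m (- w.2 + hada be (A *m w.1.1 + w.1.2 - X)))) =
    prox_obj f th (w.1.1 - hada (recip th)
      (W^T *m (hada be (A *m w.1.1 + w.1.2 - X) - w.2))) Z.
  by rewrite /prox_obj [- w.2 + _]addrC opprB addrA [Z + _ - _]addrAC.
have Eg E : g E + whnorm be (E - X + A *m w'.1.1 + hada (recip be) (- w.2)) =
    prox_obj g be (X - A *m w'.1.1 + hada (recip be) w.2) E.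
  by rewrite /prox_obj hadaN !opprD opprK !addrA.
split=> [[Hf [Hg Hl]]|[Hf Hg Hl]].
  split; [exact: is_argmin_ext Hf | exact: is_argmin_ext Hg | ].
  by rewrite -[LHS]opprK Hl opprD opprK.
split; first exact: is_argmin_ext (fun Z => esym (Ef Z)) Hf.
split; first exact: is_argmin_ext (fun E => esym (Eg E)) Hg.
by rewrite Hl opprB addrC.
Qed.

(** The multiplier update is exactly the optimality condition of the [E]-problem, so the new third
    component is itself a subgradient of [g]. *)
Lemma dladmm_step_inclusions {R : realType} {m d n} (A W : 'M[R]_(m, d)) (X : 'M[R]_(m, n))
    f g (th : 'M[R]_(d, n)) be (w w' : triple R m d n) :
  convex_fun f -> convex_fun g -> entrywise_pos th -> entrywise_pos be ->
  dladmm_step A X f g W th be w w' ->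
  [/\ subdiff f w'.1.1 (W^T *m (w.2 - hada be (A *m w.1.1 + w.1.2 - X))
                        - hada th (w'.1.1 - w.1.1)),
      subdiff g w'.1.2 w'.2 &
      w'.2 = w.2 - hada be (A *m w'.1.1 + w'.1.2 - X)].
Proof.
move=> cf cg th0 be0 /dladmm_stepP[Hf Hg Hl]; split=> //.
  have := argmin_subdiff _ _ _ _ cf th0 Hf; congr (subdiff f _ _).
  rewrite addrAC -(opprB w'.1.1) -opprD hadaN [in LHS]hadaD hadaVK//.
  by rewrite opprD addrC -mulmxN opprB.
have := argmin_subdiff _ _ _ _ cg be0 Hg; congr (subdiff g _ _).
rewrite Hl; move: (A *m w'.1.1) => U.
have -> : X - U + hada (recip be) w.2 - w'.1.2 = hada (recip be) w.2 - (U + w'.1.2 - X).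
  by move: (hada _ _) => V; apply/matrixP => i j; rewrite !mxE; ring.
by rewrite hadaD hadaN hadaVK.
Qed.

Lemma dladmm_step_exists {R : realType} {m d n} (A W : 'M[R]_(m, d)) (X : 'M[R]_(m, n))
    f g (th : 'M[R]_(d, n)) be (w : triple R m d n) :
  convex_fun f -> convex_fun g -> entrywise_pos th -> entrywise_pos be ->
  Omega_star A X f g !=set0 ->
  exists w', dladmm_step A X f g W th be w w'.
Proof.
move=> cf cg th0 be0 [_ [Zs [Es [ls [_ [HZ [HE _]]]]]]].
have [Z minZ] := prox_exists f th (w.1.1 - hada (recip th)
  (W^T *m (hada be (A *m w.1.1 + w.1.2 - X) - w.2))) _ _ cf th0 HZ.
have [E minE] := prox_exists g be (X - A *m Z + hada (recip be) w.2) _ _ cg be0 HE.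
exists (Z, E, w.2 - hada be (A *m Z + E - X)).
exact/dladmm_stepP.
Qed.

(** * The [H]-norm for [W = A] and Fejer monotonicity *)

Lemma Hnorm2E {R : realType} {m d n} (A : 'M[R]_(m, d)) (th : 'M[R]_(d, n)) be u :
  Hnorm2 A A th be u =
  wsq th u.1.1 - wsq be (A *m u.1.1) + wsq be u.1.2 + wsq (recip be) u.2.
Proof.
by rewrite /Hnorm2 /tinner /Hop /Dop/= frobBr (frobC u.1.1 (A^T *m _)) frob_adj frobC /wsq
  (frobC _ (A *m _)) (frobC _ u.1.1).
Qed.

Lemma Omega_starP {R : realType} {m d n} (A : 'M[R]_(m, d)) (X : 'M[R]_(m, n)) f g ws :
  Omega_star A X f g ws ->
  [/\ subdiff f ws.1.1 (A^T *m ws.2), subdiff g ws.1.2 ws.2 & A *m ws.1.1 + ws.1.2 = X].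
Proof. by move=> [Z [E [l [-> [HZ [HE HX]]]]]]; rewrite /= mulmxN. Qed.

(* [subdiff g w.1.2 w.2] holds after any step; it controls the cross term between the
   increments of [E] and [lambda]. *)
Lemma fejer {R : realType} {m d n} (A : 'M[R]_(m, d)) (X : 'M[R]_(m, n)) f g
    (th : 'M[R]_(d, n)) be (w w' ws : triple R m d n) :
  convex_fun f -> convex_fun g -> entrywise_pos th -> entrywise_pos be ->
  subdiff g w.1.2 w.2 -> dladmm_step A X f g A th be w w' -> Omega_star A X f g ws ->
  Hnorm2 A A th be (tsub w' ws) <=
  Hnorm2 A A th be (tsub w ws) - Hnorm2 A A th be (tsub w' w).
Proof.
move=> cf cg th0 be0 gw /(dladmm_step_inclusions _ _ _ _ _ _ _ _ _ cf cg th0 be0).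
move=> [fw' gw' Lw'] /Omega_starP[fs gs Xs].
have h1 := subdiff_monotone _ _ _ _ _ fw' fs.
have h2 := subdiff_monotone _ _ _ _ _ gw' gs.
have h3 := subdiff_monotone _ _ _ _ _ gw' gw.
rewrite !Hnorm2E /tsub /=.
have sub_subl (p q : nat) (x y z : 'M[R]_(p, q)) : x - z = (y - z) - (y - x).
  by apply/matrixP => i j; rewrite !mxE; ring.
(* Everything is expressed through the error [s = w' - ws] and the step [d = w' - w]; the claim
   becomes that the [H]-inner product of [s] and [d] is nonpositive. *)
rewrite (sub_subl _ _ w.1.1 w'.1.1) (sub_subl _ _ w.1.2 w'.1.2) (sub_subl _ _ w.2 w'.2).
have Lr : w.2 - hada be (A *m w.1.1 + w.1.2 - X) =
    w'.2 + hada be (A *m (w'.1.1 - w.1.1) + (w'.1.2 - w.1.2)).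
  by rewrite Lw' mulmxBr; apply/matrixP => i j; rewrite !mxE; ring.
(* The multiplier update and feasibility of [ws] determine [A *m sZ], which is then eliminated from
   the monotonicity of [f]. *)
have As : A *m (w'.1.1 - ws.1.1) = - (w'.1.2 - ws.1.2) - hada (recip be) (w'.2 - w.2).
  rewrite mulmxBr Lw' addrAC subrr add0r hadaN opprK hadaK// -Xs.
  by apply/matrixP => i j; rewrite !mxE; ring.
rewrite Lr in h1.
have {}h1 : 0 <= frob (w'.2 - ws.2 + hada be (A *m (w'.1.1 - w.1.1) + (w'.1.2 - w.1.2)))
     (A *m (w'.1.1 - ws.1.1)) - frob (w'.1.1 - ws.1.1) (hada th (w'.1.1 - w.1.1)).
  rewrite (frobC _ (hada th _)); move: h1.
  by rewrite !frobBl !frob_adj !frobDl frobNl; lra.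
move: As h1 h2 h3; rewrite [A *m (_ - (w'.1.1 - _))]mulmxBr.
move: (w'.1.1 - ws.1.1) (w'.1.2 - ws.1.2) (w'.2 - ws.2).
move: (w'.1.1 - w.1.1) (w'.1.2 - w.1.2) (w'.2 - w.2) => dZ dE dL sZ sE sL As h1 h2 h3.
rewrite !wsqB.
rewrite frobDl hadaD !frobDl in h1.
have e1 : frob sL (A *m sZ) = - frob sL sE - frob sL (hada (recip be) dL).
  by rewrite As frobBr frobNr.
(* The leftover [- frob dL dE] is the cross term whose sign [h3] provides; [h2] does the same for
   [frob sL sE]. *)
have e2 : frob (hada be dE) (A *m sZ) = - frob sE (hada be dE) - frob dL dE.
  by rewrite As frobBr frobNr -(frob_hada be dE (hada _ _)) hadaVK// (frobC _ sE) (frobC dE).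
rewrite (frobC (hada be (A *m dZ))) in h1.
by lra.
Qed.

(** * From the error bound at the trial point to the next iterate *)

Definition wnorm {R : realType} {m d n} (th : 'M[R]_(d, n)) (be : 'M[R]_(m, n))
  (u : triple R m d n) : R := wsq th u.1.1 + wsq be u.1.2 + wsq (recip be) u.2.

Lemma wnorm_ge0 {R : realType} {m d n} (th : 'M[R]_(d, n)) (be : 'M[R]_(m, n)) u :
  entrywise_pos th -> entrywise_pos be -> 0 <= wnorm th be u.
Proof.
move=> th0 be0; have re0 := recip_pos _ be0.
by rewrite /wnorm !addr_ge0// wsq_ge0.
Qed.

Lemma wnorm_subC {R : realType} {m d n} (th : 'M[R]_(d, n)) (be : 'M[R]_(m, n)) u v :
  wnorm th be (tsub u v) = wnorm th be (tsub v u).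
Proof.
have subC (p q : nat) (a x y : 'M[R]_(p, q)) : wsq a (x - y) = wsq a (y - x).
  by rewrite -wsqN opprB.
by rewrite /wnorm /tsub /=; congr (_ + _ + _); exact: subC.
Qed.

Lemma wnorm_sub_le {R : realType} {m d n} (th : 'M[R]_(d, n)) (be : 'M[R]_(m, n)) u v w :
  entrywise_pos th -> entrywise_pos be ->
  wnorm th be (tsub u w) <= 2 * (wnorm th be (tsub u v) + wnorm th be (tsub v w)).
Proof.
move=> th0 be0; have re0 := recip_pos _ be0.
have split_sub (p q : nat) (x y z : 'M[R]_(p, q)) : x - z = (x - y) + (y - z).
  by rewrite addrA subrK.
rewrite /wnorm /tsub /=.
rewrite (split_sub _ _ u.1.1 v.1.1) (split_sub _ _ u.1.2 v.1.2) (split_sub _ _ u.2 v.2).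
have := wsqD_le th (u.1.1 - v.1.1) (v.1.1 - w.1.1) th0.
have := wsqD_le be (u.1.2 - v.1.2) (v.1.2 - w.1.2) be0.
have := wsqD_le (recip be) (u.2 - v.2) (v.2 - w.2) re0.
lra.
Qed.

(** [wnorm] is [Hnorm2] without its negative term [- wsq be (A *m Z)]; it serves as the Euclidean
    reference norm. *)
Lemma Hnorm2_le_wnorm {R : realType} {m d n} (A : 'M[R]_(m, d)) (th : 'M[R]_(d, n)) be u :
  entrywise_pos be -> Hnorm2 A A th be u <= wnorm th be u.
Proof. by move=> be0; rewrite Hnorm2E /wnorm; have := wsq_ge0 be (A *m u.1.1) be0; lra. Qed.

(* [Hnorm2] may be indefinite here, but the [E]-component of [wt - ws] is tied to its
   [Z]-component up to the multiplier increment, and on the graph of that constraint the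
   negative term [- wsq be (A *m Z)] cancels. *)
Lemma wnorm_le_Hnorm2 {R : realType} {m d n} (A : 'M[R]_(m, d)) (X : 'M[R]_(m, n))
    (th : 'M[R]_(d, n)) be : entrywise_pos th -> entrywise_pos be ->
  exists2 C : R, 0 < C & forall w wt ws : triple R m d n,
    wt.2 = w.2 - hada be (A *m wt.1.1 + wt.1.2 - X) -> A *m ws.1.1 + ws.1.2 = X ->
    wnorm th be (tsub wt ws) <=
    C * (Hnorm2 A A th be (tsub wt ws) + C * wnorm th be (tsub wt w)).
Proof.
move=> th0 be0; have re0 := recip_pos _ be0.
have [K K0 HK] := wsq_mul_le A be th be0 th0.
exists (2 + 4 * K) => [|w wt ws Lt Xs]; first by rewrite addr_gt0 ?mulr_gt0.
rewrite Hnorm2E /wnorm /tsub /=.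
have Es : wt.1.2 - ws.1.2 = - (A *m (wt.1.1 - ws.1.1) + hada (recip be) (wt.2 - w.2)).
  rewrite mulmxBr Lt [w.2 - _ - w.2]addrAC subrr add0r hadaN hadaK// -Xs.
  by apply/matrixP => i j; rewrite !mxE; ring.
move: (wt.1.1 - ws.1.1) (wt.1.2 - ws.1.2) (wt.2 - ws.2) Es => sZ sE sL ->.
have rL : wsq be (hada (recip be) (wt.2 - w.2)) = wsq (recip be) (wt.2 - w.2).
  by rewrite /wsq hadaVK// frobC.
have dZ0 := wsq_ge0 th (wt.1.1 - w.1.1) th0.
have dE0 := wsq_ge0 be (wt.1.2 - w.1.2) be0.
move: (hada (recip be) _) rL => r <-.
rewrite wsqN; have r0 := wsq_ge0 be r be0.
have E2 := wsqD_le be (A *m sZ) r be0.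
(* With this Young parameter the cross term of [A *m sZ] and [r] costs at most half of
   [wsq th sZ]. *)
have K2 : 0 < (2 * K)^-1 by rewrite invr_gt0 mulr_gt0.
have Y := wsq_young be (- (A *m sZ)) r _ be0 K2.
rewrite invrK wsqN frobNl in Y.
have KZ := HK sZ.
have KZ2 : (2 * K)^-1 * wsq be (A *m sZ) <= 2^-1 * wsq th sZ.
  by rewrite invfM -mulrA ler_wpM2l ?invr_ge0// mulrC ler_pdivrMr// mulrC.
have Z0 := wsq_ge0 th sZ th0; have L0 := wsq_ge0 (recip be) sL re0.
have e2 := wsqD be (A *m sZ) r.
move: (wsq th sZ) (wsq (recip be) sL) (wsq be r) (wsq be (A *m sZ)) (wsq be (_ + _))
  (wsq th _) (wsq be (wt.1.2 - _)) (frob _ _) K0 dZ0 dE0 E2 r0 Y KZ KZ2 Z0 L0 e2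
  => a l r2 az s dz de F K0 dZ0 dE0 E2 r0 Y KZ KZ2 Z0 L0 e2.
have H1 : 2^-1 * a + l <= a - az + s + l + 2 * K * r2 by lra.
(* From [s <= 2 * (az + r2)] and [az <= K * a]; the factor is [1 + 2 * K], doubled because [H1]
   controls only half of [a]. *)
have H2 : a + s + l <= (2 + 4 * K) * (2^-1 * a + l) + 2 * r2 by nra.
have C0 : 0 <= 2 + 4 * K by lra.
have H3 := ler_wpM2l C0 H1.
have v0 : 0 <= dz + de by lra.
have H4 : 2 * r2 <= (2 + 4 * K) * 2 * r2 by nra.
have H5 : 0 <= (2 + 4 * K) * (2 + 4 * K) * (dz + de) by rewrite !mulr_ge0.
nra.
Qed.

(** The [Z]-inclusions at the two points share their linear term and differ by the extra [(s - 1)]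
    multiple of the [Z]-increment, so monotonicity bounds their [Z]-distance. The [E]- and
    multiplier distances follow from it. *)
Lemma step_scale_compare {R : realType} {m d n} (A : 'M[R]_(m, d)) (X : 'M[R]_(m, n)) f g
    (th : 'M[R]_(d, n)) be (s : R) :
  convex_fun f -> convex_fun g -> entrywise_pos th -> entrywise_pos be -> 1 <= s ->
  exists2 C : R, 0 < C & forall w w' wt,
    dladmm_step A X f g A (s *: th) be w w' -> dladmm_step A X f g A th be w wt ->
    wnorm th be (tsub w' wt) <= C * wnorm th be (tsub w' w).
Proof.
move=> cf cg th0 be0 s1; have re0 := recip_pos _ be0.
have [K K0 HK] := wsq_mul_le A be th be0 th0.
have s0 : 0 < s by exact: lt_le_trans s1.
have sth0 : entrywise_pos (s *: th) by move=> i j; rewrite mxE mulr_gt0.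
(* [s ^+ 2] comes from [xbound]; in units of [wsq th x] the [Z], [E] and multiplier parts cost [1],
   [K] and [4 * K]. *)
exists ((1 + 5 * K) * s ^+ 2) => [|w w' wt].
  by rewrite mulr_gt0 ?exprn_gt0// addr_gt0// mulr_gt0.
move=> /(dladmm_step_inclusions _ _ _ _ _ _ _ _ _ cf cg sth0 be0)[f1 g1 L1].
move=> /(dladmm_step_inclusions _ _ _ _ _ _ _ _ _ cf cg th0 be0)[f2 g2 L2].
have h1 := subdiff_monotone _ _ _ _ _ f1 f2.
have h2 := subdiff_monotone _ _ _ _ _ g1 g2.
rewrite /wnorm /tsub /=.
have y2 := wsq_ge0 be (w'.1.2 - w.1.2) be0.
have y3 := wsq_ge0 (recip be) (w'.2 - w.2) re0.
have Lx : w'.2 - wt.2 = - hada be (A *m (w'.1.1 - wt.1.1) + (w'.1.2 - wt.1.2)).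
  by rewrite L1 L2 mulmxBr; apply/matrixP => i j; rewrite !mxE; ring.
have {}h1 : 0 <= frob (- hada th (w'.1.1 - wt.1.1) - (s - 1) *: hada th (w'.1.1 - w.1.1))
                      (w'.1.1 - wt.1.1).
  by move: h1; congr (0 <= frob _ _); apply/matrixP => i j; rewrite !mxE; ring.
rewrite Lx frobNl in h2.
move: (w'.1.1 - wt.1.1) (w'.1.2 - wt.1.2) (w'.2 - wt.2) h1 h2 Lx => x xE xL h1 h2 ->.
move: (w'.1.1 - w.1.1) (wsq be (w'.1.2 - _)) (wsq _ (w'.2 - _)) h1 y2 y3
  => y v2 v3 h1 y2 y3.
have Lsq : wsq (recip be) (- hada be (A *m x + xE)) = wsq be (A *m x + xE).
  by rewrite wsqN /wsq hadaK// frobC.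
rewrite Lsq; have E2 := wsqD_le be (A *m x) xE be0.
have x0 := wsq_ge0 th x th0; have yy0 := wsq_ge0 th y th0.
have xbound : wsq th x <= s ^+ 2 * wsq th y.
  have := wsq_young th (- x) ((s - 1) *: y) 1 th0 ltr01.
  rewrite wsqN wsqZ hadaZ frobNl frobZr invr1.
  rewrite frobBl frobNl frobZl -[frob (hada th y) x]frobC (frobC (hada th x)) -/(wsq th x) in h1.
  move: (frob x _) h1 => F h1 h3.
  have s2 : (s - 1) ^+ 2 <= s ^+ 2 by nra.
  have := ler_wpM2r yy0 s2; lra.
have Ebound : wsq be xE <= wsq be (A *m x).
  have := wsq_young be (- (A *m x)) xE 1 be0 ltr01.
  rewrite wsqN frobNl invr1.
  rewrite -frob_hada frobDl -/(wsq be xE) in h2.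
  by move: (wsq be xE) (wsq be _) (frob _ _) h2 => *; lra.
have KX := HK x.
have : wsq th x + wsq be xE + wsq be (A *m x + xE) <= (1 + 5 * K) * wsq th x by lra.
have C0 : 0 <= 1 + 5 * K by lra.
have := ler_wpM2l C0 xbound.
have : 0 <= (1 + 5 * K) * s ^+ 2 * (v2 + v3) by rewrite mulr_ge0 ?addr_ge0// mulr_ge0// sqr_ge0.
move: (wsq th x) (wsq be xE) (wsq be _) (wsq th y) => *; lra.
Qed.

(** Triangle inequality through [wt]: [step_scale_compare] handles [w'] to [wt], and
    [wnorm_le_Hnorm2] with the error bound handles [wt] to a nearly closest solution. *)
Lemma error_bound_transfer {R : realType} {m d n} (A : 'M[R]_(m, d)) (X : 'M[R]_(m, n)) f g
    (th : 'M[R]_(d, n)) be (s kappa : R) :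
  convex_fun f -> convex_fun g -> entrywise_pos th -> entrywise_pos be ->
  1 <= s -> 0 <= kappa ->
  exists2 C : R, 0 < C & forall w w' wt,
    dladmm_step A X f g A (s *: th) be w w' -> dladmm_step A X f g A th be w wt ->
    (dist2 A A th be (Omega_star A X f g) wt <=
      kappa%:E * (Hnorm2 A A th be (tsub wt w))%:E)%E ->
    (dist2 A A (s *: th) be (Omega_star A X f g) w' <=
      (C * wnorm th be (tsub w' w))%:E)%E.
Proof.
move=> cf cg th0 be0 s1 k0.
have s0 : 0 < s by exact: lt_le_trans s1.
have [C C0 HC] := wnorm_le_Hnorm2 A X th be th0 be0.
have [D D0 HD] := step_scale_compare A X f g th be s cf cg th0 be0 s1.
exists (s * (2 * (D + C * ((kappa + C) * (2 * (D + 1)))))).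
  have E0 : 0 < kappa + C by rewrite ltr_wpDl.
  by rewrite mulr_gt0// mulr_gt0// addr_gt0// mulr_gt0// mulr_gt0// mulr_gt0// addr_gt0.
move=> w w' wt sw' swt eb.
apply/lee_addgt0Pr => e e0.
(* The infimum need not be attained here, so a solution within [e'] is chosen; the scaling returns
   the slack as [e] at the end of the chain. *)
pose e' := e / (s * (2 * C)).
have e'0 : 0 < e' by rewrite divr_gt0 ?mulr_gt0.
have : (dist2 A A th be (Omega_star A X f g) wt <
    (kappa * Hnorm2 A A th be (tsub wt w) + e')%:E)%E.
  by rewrite (le_lt_trans eb)// -EFinM lte_fin ltrDl.
move=> /ereal_inf_lt[_ [ws Ows <-]]; rewrite lte_fin => /ltW Hws.
apply: (@le_trans _ _ (Hnorm2 A A (s *: th) be (tsub w' ws))%:E).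
  by apply: ereal_inf_lbound; exists ws.
rewrite -EFinD lee_fin.
have [_ _ Lt] := dladmm_step_inclusions _ _ _ _ _ _ _ _ _ cf cg th0 be0 swt.
have [_ _ Xs] := Omega_starP _ _ _ _ _ Ows.
have h1 := HC w wt ws Lt Xs; have h2 := HD w w' wt sw' swt.
have h3 := wnorm_sub_le th be w' wt ws th0 be0.
have h4 : wnorm th be (tsub wt w) <= 2 * (wnorm th be (tsub w' wt) + wnorm th be (tsub w' w)).
  by rewrite (wnorm_subC _ _ w' wt); exact: wnorm_sub_le.
have h5 := Hnorm2_le_wnorm A th be (tsub wt w) be0.
have h6 : Hnorm2 A A (s *: th) be (tsub w' ws) <= s * wnorm th be (tsub w' ws).
  apply: le_trans (Hnorm2_le_wnorm _ _ _ _ be0) _.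
  have sE : wsq (s *: th) (w'.1.1 - ws.1.1) = s * wsq th (w'.1.1 - ws.1.1).
    by rewrite /wsq -frobZr; congr frob; apply/matrixP => i j; rewrite !mxE mulrA.
  rewrite /wnorm /tsub /= sE; have := wsq_ge0 be (w'.1.2 - ws.1.2) be0.
  have := wsq_ge0 _ (w'.2 - ws.2) (recip_pos _ be0); nra.
have He' : s * (2 * (C * e')) = e.
  by rewrite /e'; field; rewrite !gt_eqF.
clearbody e'.
move: (wnorm th be (tsub w' w)) (wnorm th be (tsub wt w)) (wnorm th be (tsub w' wt))
  (wnorm th be (tsub wt ws)) (wnorm th be (tsub w' ws)) (Hnorm2 A A th be (tsub wt ws))
  (Hnorm2 A A th be (tsub wt w)) (Hnorm2 A A (s *: th) be _) Hws h1 h2 h3 h4 h5 h6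
  => v0 v1 v2 v3 v4 H1 H2 H3 Hws h1 h2 h3 h4 h5 h6.
have k1 := ler_wpM2l k0 h5.
have v1b : v1 <= 2 * (D + 1) * v0 by lra.
have kC0 : 0 <= kappa + C by rewrite addr_ge0// ltW.
have k2 := ler_wpM2l kC0 v1b.
have k3 : H1 + C * v1 <= (kappa + C) * (2 * (D + 1) * v0) + e' by lra.
have k4 := ler_wpM2l (ltW C0) k3.
have k5 : v4 <= 2 * (D * v0 + C * ((kappa + C) * (2 * (D + 1) * v0) + e')) by lra.
have k6 := ler_wpM2l (ltW s0) k5.
rewrite -He'; lra.
Qed.

(** * Admissible parameters and the contraction *)

Lemma wsq0 {R : realType} {p q} (a : 'M[R]_(p, q)) : wsq a 0 = 0.
Proof. by rewrite -(scale0r (0 : 'M_(p, q))) wsqZ expr0n mul0r. Qed.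

Lemma wsq_gt0 {R : realType} {p q} (a M : 'M[R]_(p, q)) :
  entrywise_pos a -> M != 0 -> 0 < wsq a M.
Proof.
move=> a0 M0; rewrite lt_def wsq_ge0// andbT; apply: contraNneq M0 => Q0.
apply/eqP/matrixP => i j; have := wsq_entry a M i j a0.
by rewrite Q0 mxE pmulr_rle0// => M2; apply/eqP; rewrite -sqrf_eq0 eq_le M2 sqr_ge0.
Qed.

Lemma specnorm0 {R : realType} {p q} : specnorm (0 : 'M[R]_(p, q)) = 0.
Proof.
rewrite /specnorm (_ : [set _ | _ in _] = [set 0]) ?sup1//.
have f0 (N : 'M[R]_(p, 1)) : frob 0 N = 0 by rewrite -(scale0r 0) frobZl mul0r.
apply/seteqP; split => [_ [v _ <-]|_ ->] /=; first by rewrite mul0mx f0 sqrtr0.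
by exists 0; rewrite /= ?mul0mx ?f0 ?sqrtr0// -(scale0r 0) frobZl mul0r.
Qed.

(** With [s = 1 + K] the extra [K * wsq th Z] absorbs [wsq be (A *m Z)]. *)
Lemma wnorm_le_scaled_Hnorm2 {R : realType} {m d n} (A : 'M[R]_(m, d))
    (th : 'M[R]_(d, n)) be : entrywise_pos th -> entrywise_pos be ->
  exists2 s : R, 1 <= s & forall u, wnorm th be u <= Hnorm2 A A (s *: th) be u.
Proof.
move=> th0 be0; have [K K0 HK] := wsq_mul_le A be th be0 th0.
exists (1 + K) => [|u]; first by rewrite lerDl ltW.
rewrite Hnorm2E /wnorm.
have -> : wsq ((1 + K) *: th) u.1.1 = (1 + K) * wsq th u.1.1.
  by rewrite /wsq -frobZr; congr frob; apply/matrixP => i j; rewrite !mxE mulrA.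
by have := HK u.1.1; lra.
Qed.

Theorem theorem3 (R : realType) (m d n : nat)
  (A : 'M[R]_(m, d)) (X : 'M[R]_(m, n))
  (f : 'M[R]_(d, n) -> R) (g : 'M[R]_(m, n) -> R)
  (hf : convex_fun f) (hg : convex_fun g)
  (c : R)
  (hS : forall s : R, 0 <= s <= c ->
     exists W th be, @Sset R m d n A s W th be)
  (hOm : Omega_star A X f g !=set0)
  (sigma : R) (hsigma : 0 <= sigma <= c)
  (th_star : 'M[R]_(d, n)) (be_star : 'M[R]_(m, n))
  (hth : entrywise_pos th_star) (hbe : entrywise_pos be_star)
  (kappa : R) (hkappa : 0 < kappa) (K0 : nat) (hK0 : (0 < K0)%N)
  (w0 : triple R m d n) :
  exists (W : nat -> 'M[R]_(m, d)) (th : nat -> 'M[R]_(d, n)) (be : nat -> 'M[R]_(m, n))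
         (gamma : R),
    (forall k, Sset A sigma (W k) (th k) (be k)) /\ 0 < gamma < 1 /\
    forall w : nat -> triple R m d n,
      w 0%N = w0 ->
      (forall k, dladmm_step A X f g (W k) (th k) (be k) (w k) (w k.+1)) ->
      (forall k, (K0 <= k)%N -> forall wt, dladmm_step A X f g A th_star be_star (w k) wt ->
         (dist2 A A th_star be_star (Omega_star A X f g) wt <=
          (kappa / 16)%:E * (Hnorm2 A A th_star be_star (tsub wt (w k)))%:E)%E) ->
      forall k, (K0 <= k)%N ->
        (dist2 A (W k.+1) (th k.+1) (be k.+1) (Omega_star A X f g) (w k.+1) <=
         gamma%:E * dist2 A (W k) (th k) (be k) (Omega_star A X f g) (w k))%E.
Proof.
have [s s1 Hs] := wnorm_le_scaled_Hnorm2 A th_star be_star hth hbe.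
have s0 : 0 < s by exact: lt_le_trans s1.
have sth0 : entrywise_pos (s *: th_star) by move=> i j; rewrite mxE mulr_gt0.
have k16 : 0 <= kappa / 16 by rewrite divr_ge0// ltW.
have [C C0 HC] := error_bound_transfer A X f g _ _ s _ hf hg hth hbe s1 k16.
have H0 u : 0 <= Hnorm2 A A (s *: th_star) be_star u.
  exact: le_trans (wnorm_ge0 _ _ u hth hbe) (Hs u).
have C1 : 0 < 1 + C by rewrite addr_gt0.
(* With [p] the squared step and [q] the squared distance of [w k] to a solution, [D <= C * p] and
   [D <= q - p] combine to [(1 + C) * D <= C * q]. *)
exists (fun=> A), (fun=> s *: th_star), (fun=> be_star), (C / (1 + C)).
split=> [_|].
  split; first by rewrite subrr specnorm0; case/andP: hsigma.
  split=> //; split=> // Z Z0.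
  (* On triples [(Z, 0, 0)] the comparison with [wnorm] is positive definiteness of the
     [Z]-operator. *)
  have := Hs (Z, 0, 0); rewrite Hnorm2E /wnorm /=.
  rewrite !wsq0 !addr0 => /(lt_le_trans (wsq_gt0 _ _ hth Z0)).
  by rewrite /Dop frobBl frob_adj -frob_hada /wsq -(frob_hada be_star).
split.
  by rewrite divr_gt0//= ltr_pdivrMr// mul1r ltrDr.
move=> w _ Hw Heb k K0k.
have gk : subdiff g (w k).1.2 (w k).2.
  (* Since [k >= K0 > 0], the point [w k] is itself the output of a step. *)
  case: k K0k => [|k _]; first by rewrite leqNgt hK0.
  by have [] := dladmm_step_inclusions _ _ _ _ _ _ _ _ _ hf hg sth0 hbe (Hw k).
(* The error bound speaks of every trial point, so one must exist for it to be applied. *)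
have [wt swt] := dladmm_step_exists A A X f g th_star be_star (w k) hf hg hth hbe hOm.
set D := dist2 _ _ _ _ _ (w k.+1).
have D1 : (D <= (C * Hnorm2 A A (s *: th_star) be_star (tsub (w k.+1) (w k)))%:E)%E.
  apply: le_trans (HC _ _ _ (Hw k) swt (Heb k K0k wt swt)) _.
  by rewrite lee_fin ler_pM2l.
have Dge0 : (0 <= D)%E.
  by apply: le_ereal_inf_tmp => _ [ws _ <-]; rewrite lee_fin.
have D2 ws : Omega_star A X f g ws ->
    (D <= (Hnorm2 A A (s *: th_star) be_star (tsub (w k) ws) -
           Hnorm2 A A (s *: th_star) be_star (tsub (w k.+1) (w k)))%:E)%E.
  move=> Ows; apply: (@le_trans _ _ (Hnorm2 A A (s *: th_star) be_star (tsub (w k.+1) ws))%:E).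
    by apply: ereal_inf_lbound; exists ws.
  by rewrite lee_fin; exact: fejer (Hw k) Ows.
(* Moving [gamma] to the left turns the goal into a lower bound for an infimum, checked solution by
   solution. *)
rewrite -lee_pdivrMl ?divr_gt0//.
apply: le_ereal_inf_tmp => _ [ws Ows <-]; rewrite lee_pdivrMl ?divr_gt0//.
(* [D1] excludes [+oo] and [Dge0] excludes [-oo], so the rest is real arithmetic. *)
move: D1 Dge0 (D2 ws Ows); clear D2; case: D => [x| |]//.
rewrite !lee_fin => D1 _ D2'; rewrite mulrAC ler_pdivlMr//.
by have := ler_wpM2l (ltW C0) D2'; lra.
Qed.
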